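(* Let $\mathscr K$ be a commutative Noetherian ring, $H$ a $\mathscr K$-algebra which is finite and projective over $\mathscr K$, and $(\mathscr A,\mathscr E)$ a strict and full exact subcategory of mod-$H$. Let $\mathscr S$ be the strict full additive subcategory of $\mathscr A$ generated by a finite set $\{S_\omega\}_{\omega\in\Omega}$ of nonzero objects indexed by a finite set $\Omega$. Assume that for each $\omega\in\Omega$ there exists an object $X_\omega\in\mathscr A_{\mathscr E}(\mathscr S)$ such that (1) $X_\omega$ has an $\mathscr E$-filtration with lowest section $S_\omega$ and all other sections in $\mathscr S$, and (2) $\mathrm{Ext}^1_{\mathscr E}(S_{\omega'},X_\omega)=0$ for all $\omega,\omega'\in\Omega$. Let $A^\dagger=\mathrm{End}_H(T^\dagger)$, where $T^\dagger=\bigoplus_{\omega\in\Omega}X_\omega$. Then the Morita class of $A^\dagger$ is independent of the choices of the $X_\omega$ satisfying (1) and (2); that is, if $\{X_\omega\}_{\omega\in\Omega}$ and $\{Y_\omega\}_{\omega\in\Omega}$ are two families of objects of $\mathscr A_{\mathscr E}(\mathscr S)$ each satisfying (1) and (2), then $\mathrm{End}_H(\bigoplus_\omega X_\omega)$ and $\mathrm{End}_H(\bigoplus_\omega Y_\omega)$ are Morita equivalent.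
   Context: mod-$H$ is the category of finitely generated right $H$-modules. A strict and full exact subcategory $(\mathscr A,\mathscr E)$ of mod-$H$ is an exact category in the sense of Quillen such that $\mathscr A$ is a full additive subcategory of mod-$H$ closed under isomorphism, and every conflation in $\mathscr E$ is a short exact sequence in mod-$H$. $\mathrm{Ext}^1_{\mathscr E}(Y,Z)$ is the group of equivalence classes of sequences $0\to Z\to E\to Y\to 0$ in $\mathscr E$. For $M\in\mathscr A$, a filtration $0=M^{-1}\subseteq M^0\subseteq\cdots\subseteq M^\ell=M$ in mod-$H$ is an $\mathscr E$-filtration if each sequence $0\to M^{i-1}\to M^i\to M^i/M^{i-1}\to0$ ($0\le i\le \ell$) is a conflation in $\mathscr E$; its sections are the $M^i/M^{i-1}$ and the lowest section is $M^0$ (up to isomorphism). Objects of $\mathscr S$ are the modules isomorphic to finite direct sums of objects $S_\omega$. $\mathscr A_{\mathscr E}(\mathscr S)$ consists of the objects of $\mathscr A$ having an $\mathscr E$-filtration with all sections in $\mathscr S$. *)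

(* Defs.v *)
From HB Require Import structures.
From mathcomp Require Import all_boot all_algebra.
From mathcomp Require Import boolp.

Set Implicit Arguments.
Unset Strict Implicit.
Unset Printing Implicit Defensive.

Import GRing.Theory.
Local Open Scope ring_scope.
Local Open Scope quotient_scope.

(* Right R-modules are left modules over the converse ring R^c, so that
   [a *: x : M] is the right action "x.a". The general notions below are
   stated for [lmodType R] and get instantiated at R^c. *)
Notation rmodType R := (lmodType R^c).

Section Modules.
Variable R : pzRingType.
Implicit Types M N : lmodType R.

Definition finitely_generated M : Prop :=
  exists (n : nat) (e : 'I_n -> M),
    forall x : M, exists c : 'I_n -> R, x = \sum_(i < n) c i *: e i.

Definition projective (P : lmodType R) : Prop :=
  forall M N (g : {linear M -> N}) (f : {linear P -> N}),
    (forall y : N, exists x : M, g x = y) ->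
    exists h : {linear P -> M}, g \o h =1 f.

Definition iso M N : Prop := exists f : {linear M -> N}, bijective f.

Definition short_exact (X Y Z : lmodType R)
    (i : {linear X -> Y}) (p : {linear Y -> Z}) : Prop :=
  [/\ injective i,
      (forall y : Y, p y = 0 <-> exists x : X, i x = y)
    & (forall z : Z, exists y : Y, p y = z)].

End Modules.

Definition noetherian (K : comPzRingType) : Prop :=
  forall I : submodClosed (K^o : lmodType K),
    exists (n : nat) (e : 'I_n -> K),
      (forall i, e i \in I) /\
      (forall x : K, x \in I -> exists c : 'I_n -> K, x = \sum_(i < n) c i * e i).

(* A K-algebra is a ring H with a central morphism phi : K -> H. (MathComp's
   [algType] would exclude the zero algebra.) [alg_module phi] is H with the
   resulting K-module structure. *)
Definition central (K : comPzRingType) (H : pzRingType)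
    (phi : {rmorphism K -> H}) : Prop :=
  forall (k : K) (h : H), phi k * h = h * phi k.

Definition alg_module (K : comPzRingType) (H : pzRingType)
  (phi : {rmorphism K -> H}) : Type := H.

Section AlgModule.
Variables (K : comPzRingType) (H : pzRingType) (phi : {rmorphism K -> H}).
Local Notation V := (alg_module phi).

HB.instance Definition _ := GRing.Zmodule.copy V H.

Definition alg_scale (k : K) (x : V) : V := phi k * (x : H).

Fact alg_scaleA a b v : alg_scale a (alg_scale b v) = alg_scale (a * b) v.
Proof. by rewrite /alg_scale rmorphM mulrA. Qed.
Fact alg_scale1 : left_id 1 alg_scale.
Proof. by move=> v; rewrite /alg_scale rmorph1 mul1r. Qed.
Fact alg_scaleDr : right_distributive alg_scale +%R.
Proof. by move=> a u v; rewrite /alg_scale mulrDr. Qed.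
Fact alg_scaleDl v : {morph alg_scale^~ v : a b / a + b}.
Proof. by move=> a b; rewrite /alg_scale rmorphD mulrDl. Qed.

HB.instance Definition _ :=
  GRing.Zmodule_isLmodule.Build K V alg_scaleA alg_scale1 alg_scaleDr alg_scaleDl.
End AlgModule.

(* Finite direct sums, realised as products of finite families. *)
Definition dirsum (R : pzRingType) (I : finType) (X : I -> lmodType R) : Type :=
  forall i : I, X i.

Section DirectSum.
Variables (R : pzRingType) (I : finType) (X : I -> lmodType R).
Local Notation D := (dirsum X).

HB.instance Definition _ := Choice.copy D (forall i : I, X i).

Definition dirsum_zero : D := fun i => 0.
Definition dirsum_opp (x : D) : D := fun i => - x i.
Definition dirsum_add (x y : D) : D := fun i => x i + y i.
Definition dirsum_scale (a : R) (x : D) : D := fun i => a *: x i.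

Fact dirsum_addA : associative dirsum_add.
Proof. by move=> x y z; apply: functional_extensionality_dep => i; exact: addrA. Qed.
Fact dirsum_addC : commutative dirsum_add.
Proof. by move=> x y; apply: functional_extensionality_dep => i; exact: addrC. Qed.
Fact dirsum_add0 : left_id dirsum_zero dirsum_add.
Proof. by move=> x; apply: functional_extensionality_dep => i; exact: add0r. Qed.
Fact dirsum_addN : left_inverse dirsum_zero dirsum_opp dirsum_add.
Proof. by move=> x; apply: functional_extensionality_dep => i; exact: addNr. Qed.

HB.instance Definition _ :=
  GRing.isZmodule.Build D dirsum_addA dirsum_addC dirsum_add0 dirsum_addN.

Fact dirsum_scaleA a b v : dirsum_scale a (dirsum_scale b v) = dirsum_scale (a * b) v.
Proof. by apply: functional_extensionality_dep => i; exact: scalerA. Qed.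
Fact dirsum_scale1 : left_id 1 dirsum_scale.
Proof. by move=> v; apply: functional_extensionality_dep => i; exact: scale1r. Qed.
Fact dirsum_scaleDr : right_distributive dirsum_scale +%R.
Proof. by move=> a u v; apply: functional_extensionality_dep => i; exact: scalerDr. Qed.
Fact dirsum_scaleDl v : {morph dirsum_scale^~ v : a b / a + b}.
Proof. by move=> a b; apply: functional_extensionality_dep => i; exact: scalerDl. Qed.

HB.instance Definition _ :=
  GRing.Zmodule_isLmodule.Build R D
    dirsum_scaleA dirsum_scale1 dirsum_scaleDr dirsum_scaleDl.
End DirectSum.

(* A submodule of M is an [N : submodClosed M]; [submod N] is N as a module. *)
Definition submod (R : pzRingType) (M : lmodType R) (N : submodClosed M) : Type :=
  {x : M | x \in N}.

Section Submodule.
Variables (R : pzRingType) (M : lmodType R) (N : submodClosed M).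

HB.instance Definition _ := SubChoice.copy (submod N) {x : M | x \in N}.
HB.instance Definition _ := [SubChoice_isSubLmodule of submod N by <:].
End Submodule.

Section Inclusion.
Variables (R : pzRingType) (M : lmodType R) (N' N : submodClosed M).
Hypothesis sN'N : {subset N' <= N}.

Definition submod_incl (x : submod N') : submod N :=
  exist _ (val x) (sN'N (valP x)).

Fact submod_incl_linear : linear submod_incl.
Proof. by move=> a x y; apply: val_inj. Qed.

HB.instance Definition _ :=
  GRing.isLinear.Build R (submod N') (submod N) _ submod_incl submod_incl_linear.
End Inclusion.

(* N' \cap N as a submodule of N. *)
Definition submod_restr (R : pzRingType) (M : lmodType R)
    (N' N : submodClosed M) : {pred submod N} := fun x => val x \in N'.

Section Restriction.
Variables (R : pzRingType) (M : lmodType R) (N' N : submodClosed M).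

Fact submod_restr_closed : GRing.submod_closed (submod_restr N' (N := N)).
Proof.
have inE x : (x \in submod_restr N' (N := N)) = (val x \in N') by [].
by split=> [|a x y]; rewrite !inE ?rpred0 // => xN' yN'; rewrite rpredD ?rpredZ.
Qed.

HB.instance Definition _ :=
  GRing.isSubmodClosed.Build R (submod N) (submod_restr N' (N := N))
    submod_restr_closed.
End Restriction.

Section Quotient.
Variables (R : pzRingType) (M : lmodType R) (L : submodClosed M).

Definition quot_rel : rel M := fun x y => x - y \in L.

Fact quot_rel_equiv : equiv_class_of quot_rel.
Proof.
rewrite /quot_rel; split=> [x|x y|y x z]; first by rewrite subrr rpred0.
  by apply/idP/idP => xy; rewrite -opprB -[- (_ - _)]scaleN1r rpredZ.
by move=> xy yz; rewrite -(subrKA y) rpredD.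
Qed.

Canonical quot_equiv : equiv_rel M := EquivRelPack quot_rel_equiv.

Definition quotmod : Type := {eq_quot quot_equiv}.
HB.instance Definition _ : EqQuotient M quot_rel quotmod := EqQuotient.on quotmod.
HB.instance Definition _ := Choice.on quotmod.

Definition quot_proj (x : M) : quotmod := \pi_quotmod x.

Definition quot_zero : quotmod := quot_proj 0.
Definition quot_opp (x : quotmod) : quotmod := quot_proj (- repr x).
Definition quot_add (x y : quotmod) : quotmod := quot_proj (repr x + repr y).
Definition quot_scale (a : R) (x : quotmod) : quotmod := quot_proj (a *: repr x).

Fact quot_projP x y : quot_proj x = quot_proj y <-> x - y \in L.
Proof. by split=> [/eqquotP//|xy]; apply/eqquotP. Qed.

Fact quot_proj_surj (q : quotmod) : exists x, q = quot_proj x.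
Proof. by exists (repr q); rewrite /quot_proj reprK. Qed.

Fact repr_quot_proj x : repr (quot_proj x) - x \in L.
Proof. by apply/quot_projP; rewrite /quot_proj reprK. Qed.

Fact quot_projN x : quot_opp (quot_proj x) = quot_proj (- x).
Proof. by apply/quot_projP; rewrite -opprD -[- (_ - _)]scaleN1r rpredZ ?repr_quot_proj. Qed.

Fact quot_projD x y : quot_add (quot_proj x) (quot_proj y) = quot_proj (x + y).
Proof. by apply/quot_projP; rewrite opprD addrACA rpredD ?repr_quot_proj. Qed.

Fact quot_projZ a x : quot_scale a (quot_proj x) = quot_proj (a *: x).
Proof. by apply/quot_projP; rewrite -scalerBr rpredZ ?repr_quot_proj. Qed.

Fact quot_addA : associative quot_add.
Proof.
move=> p q r; have [x ->] := quot_proj_surj p; have [y ->] := quot_proj_surj q.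
by have [z ->] := quot_proj_surj r; rewrite !quot_projD addrA.
Qed.
Fact quot_addC : commutative quot_add.
Proof. by move=> p q; rewrite /quot_add addrC. Qed.
Fact quot_add0 : left_id quot_zero quot_add.
Proof.
by move=> p; have [x ->] := quot_proj_surj p; rewrite /quot_zero quot_projD add0r.
Qed.
Fact quot_addN : left_inverse quot_zero quot_opp quot_add.
Proof.
by move=> p; have [x ->] := quot_proj_surj p; rewrite quot_projN quot_projD addNr.
Qed.

HB.instance Definition _ :=
  GRing.isZmodule.Build quotmod quot_addA quot_addC quot_add0 quot_addN.

Fact quot_scaleA a b v : quot_scale a (quot_scale b v) = quot_scale (a * b) v.
Proof. by have [x ->] := quot_proj_surj v; rewrite !quot_projZ scalerA. Qed.
Fact quot_scale1 : left_id 1 quot_scale.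
Proof. by move=> v; have [x ->] := quot_proj_surj v; rewrite quot_projZ scale1r. Qed.
Fact quot_scaleDr : right_distributive quot_scale +%R.
Proof.
move=> a u v; have [x ->] := quot_proj_surj u; have [y ->] := quot_proj_surj v.
have -> : quot_proj x + quot_proj y = quot_proj (x + y) := quot_projD x y.
by rewrite !quot_projZ [RHS]quot_projD scalerDr.
Qed.
Fact quot_scaleDl v : {morph quot_scale^~ v : a b / a + b}.
Proof.
move=> a b; have [x ->] := quot_proj_surj v.
by rewrite !quot_projZ [RHS]quot_projD scalerDl.
Qed.

HB.instance Definition _ :=
  GRing.Zmodule_isLmodule.Build R quotmod
    quot_scaleA quot_scale1 quot_scaleDr quot_scaleDl.

Fact quot_proj_linear : linear quot_proj.
Proof. by move=> a x y; rewrite -quot_projD -quot_projZ. Qed.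

HB.instance Definition _ :=
  GRing.isLinear.Build R M quotmod _ quot_proj quot_proj_linear.
End Quotient.

Lemma linear_ext (R : pzRingType) (M N : lmodType R) (f g : {linear M -> N}) :
  f =1 g -> f = g.
Proof.
case: f g => [f [[f1] [f2]]] [g [[g1] [g2]]] /= /funext fg; subst g.
by rewrite (Prop_irrelevance f1 g1) (Prop_irrelevance f2 g2).
Qed.

(* The endomorphism ring, with composition as multiplication. *)
Definition endo (R : pzRingType) (M : lmodType R) : Type := {linear M -> M}.

Section Endomorphisms.
Variables (R : pzRingType) (M : lmodType R).
Local Notation EndM := (endo M).

HB.instance Definition _ := gen_eqMixin EndM.
HB.instance Definition _ := gen_choiceMixin EndM.

Implicit Types f g h : {linear M -> M}.

Fact endo_add_linear f g : linear (fun x => f x + g x).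
Proof. by move=> a x y; rewrite !linearP scalerDr addrACA. Qed.
Fact endo_opp_linear f : linear (fun x => - f x).
Proof. by move=> a x y; rewrite linearP opprD scalerN. Qed.
Fact endo_zero_linear : linear (fun _ : M => 0 : M).
Proof. by move=> a x y; rewrite scaler0 addr0. Qed.

Definition endo_add (f g : EndM) : EndM :=
  HB.pack (fun x => f x + g x) (GRing.isLinear.Build R M M _ _ (endo_add_linear f g)).
Definition endo_opp (f : EndM) : EndM :=
  HB.pack (fun x => - f x) (GRing.isLinear.Build R M M _ _ (endo_opp_linear f)).
Definition endo_zero : EndM :=
  HB.pack (fun _ : M => 0 : M) (GRing.isLinear.Build R M M _ _ endo_zero_linear).
Definition endo_one : EndM := (idfun : {linear M -> M}).
Definition endo_mul (f g : EndM) : EndM :=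
  ((f : {linear M -> M}) \o (g : {linear M -> M}) : {linear M -> M}).

Fact endo_addA : associative endo_add.
Proof. by move=> f g h; apply: linear_ext => x; exact: addrA. Qed.
Fact endo_addC : commutative endo_add.
Proof. by move=> f g; apply: linear_ext => x; exact: addrC. Qed.
Fact endo_add0 : left_id endo_zero endo_add.
Proof. by move=> f; apply: linear_ext => x; exact: add0r. Qed.
Fact endo_addN : left_inverse endo_zero endo_opp endo_add.
Proof. by move=> f; apply: linear_ext => x; exact: addNr. Qed.

HB.instance Definition _ :=
  GRing.isZmodule.Build EndM endo_addA endo_addC endo_add0 endo_addN.

Fact endo_mulA : associative endo_mul.
Proof. by move=> f g h; apply: linear_ext. Qed.
Fact endo_mul1 : left_id endo_one endo_mul.
Proof. by move=> f; apply: linear_ext. Qed.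
Fact endo_mulr1 : right_id endo_one endo_mul.
Proof. by move=> f; apply: linear_ext. Qed.
Fact endo_mulDl : left_distributive endo_mul +%R.
Proof. by move=> f g h; apply: linear_ext. Qed.
Fact endo_mulDr : right_distributive endo_mul +%R.
Proof. by move=> f g h; apply: linear_ext => x; exact: linearD. Qed.

HB.instance Definition _ :=
  GRing.Zmodule_isPzRing.Build EndM
    endo_mulA endo_mul1 endo_mulr1 endo_mulDl endo_mulDr.
End Endomorphisms.

Section ExactCategories.
Variable R : pzRingType.

(* A full subcategory of R-modules, and a class of composable pairs
   X -> Y -> Z of R-linear maps. *)
Definition mod_class := lmodType R -> Prop.
Definition seq_class :=
  forall X Y Z : lmodType R, {linear X -> Y} -> {linear Y -> Z} -> Prop.

Variables (A : mod_class) (E : seq_class).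

Definition inflation (X Y : lmodType R) (i : {linear X -> Y}) : Prop :=
  exists (Z : lmodType R) (p : {linear Y -> Z}), E i p.

Definition deflation (Y Z : lmodType R) (p : {linear Y -> Z}) : Prop :=
  exists (X : lmodType R) (i : {linear X -> Y}), E i p.

(* Universal properties are tested in the full subcategory A. *)
Definition is_pushout (X Y X' P : lmodType R)
    (i : {linear X -> Y}) (f : {linear X -> X'})
    (i' : {linear X' -> P}) (f' : {linear Y -> P}) : Prop :=
  [/\ A P, i' \o f =1 f' \o i
    & forall (W : lmodType R) (g : {linear X' -> W}) (h : {linear Y -> W}),
        A W -> g \o f =1 h \o i ->
        exists! u : {linear P -> W}, u \o i' =1 g /\ u \o f' =1 h].

Definition is_pullback (Y Z Z' P : lmodType R)
    (p : {linear Y -> Z}) (f : {linear Z' -> Z})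
    (p' : {linear P -> Z'}) (f' : {linear P -> Y}) : Prop :=
  [/\ A P, f \o p' =1 p \o f'
    & forall (W : lmodType R) (g : {linear W -> Z'}) (h : {linear W -> Y}),
        A W -> f \o g =1 p \o h ->
        exists! u : {linear W -> P}, p' \o u =1 g /\ f' \o u =1 h].

(* (A, E) is a strict and full exact subcategory of finitely generated
   R-modules. Quillen's axioms are given in the self-dual form due to Keller
   and Buehler. That conflations are kernel-cokernel pairs in A follows from
   [conflation_exact], A being full. *)
Record strict_full_exact_subcategory : Prop := {
  subcat_fg : forall M : lmodType R, A M -> finitely_generated M;
  subcat_iso : forall M N : lmodType R, iso M N -> A M -> A N;
  (* the case n = 0 gives the zero object *)
  subcat_dirsum : forall (n : nat) (M : 'I_n -> lmodType R),
    (forall i, A (M i)) -> A (dirsum M);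
  conflation_subcat : forall (X Y Z : lmodType R) (i : {linear X -> Y}) (p : {linear Y -> Z}),
    E i p -> [/\ A X, A Y & A Z];
  conflation_exact : forall (X Y Z : lmodType R) (i : {linear X -> Y}) (p : {linear Y -> Z}),
    E i p -> short_exact i p;
  conflation_iso : forall (X Y Z X' Y' Z' : lmodType R)
      (i : {linear X -> Y}) (p : {linear Y -> Z})
      (i' : {linear X' -> Y'}) (p' : {linear Y' -> Z'})
      (a : {linear X -> X'}) (b : {linear Y -> Y'}) (c : {linear Z -> Z'}),
    bijective a -> bijective b -> bijective c ->
    b \o i =1 i' \o a -> c \o p =1 p' \o b -> E i p -> E i' p';
  inflation_id : forall X : lmodType R, A X -> inflation (idfun : {linear X -> X});
  deflation_id : forall X : lmodType R, A X -> deflation (idfun : {linear X -> X});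
  inflation_comp : forall (X Y Z : lmodType R) (i : {linear X -> Y}) (j : {linear Y -> Z}),
    inflation i -> inflation j -> inflation (j \o i : {linear X -> Z});
  deflation_comp : forall (X Y Z : lmodType R) (p : {linear X -> Y}) (q : {linear Y -> Z}),
    deflation p -> deflation q -> deflation (q \o p : {linear X -> Z});
  inflation_pushout : forall (X Y X' : lmodType R) (i : {linear X -> Y}) (f : {linear X -> X'}),
    inflation i -> A X' ->
    exists (P : lmodType R) (i' : {linear X' -> P}) (f' : {linear Y -> P}),
      is_pushout i f i' f' /\ inflation i';
  deflation_pullback : forall (Y Z Z' : lmodType R) (p : {linear Y -> Z}) (f : {linear Z' -> Z}),
    deflation p -> A Z' ->
    exists (P : lmodType R) (p' : {linear P -> Z'}) (f' : {linear P -> Y}),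
      is_pullback p f p' f' /\ deflation p'
}.

(* Equivalence of extensions 0 -> Z -> W -> Y -> 0. *)
Definition ext_equiv (Z Y W W' : lmodType R)
    (i : {linear Z -> W}) (p : {linear W -> Y})
    (i' : {linear Z -> W'}) (p' : {linear W' -> Y}) : Prop :=
  exists b : {linear W -> W'}, [/\ bijective b, b \o i =1 i' & p' \o b =1 p].

Definition split_inj (Z Y : lmodType R) (z : Z) : (Z * Y)%type := (z, 0).

Fact split_inj_linear (Z Y : lmodType R) : linear (@split_inj Z Y).
Proof.
by move=> a x y; apply/eqP; rewrite xpair_eqE /= scaler0 addr0 !eqxx.
Qed.

HB.instance Definition _ (Z Y : lmodType R) :=
  GRing.isLinear.Build R Z (Z * Y)%type _ (@split_inj Z Y) (@split_inj_linear Z Y).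

(* Ext^1_E(Y, Z) = 0: the class of every extension of Y by Z in E is the
   neutral element, i.e. the class of the split extension. *)
Definition Ext1_eq0 (Y Z : lmodType R) : Prop :=
  forall (W : lmodType R) (i : {linear Z -> W}) (p : {linear W -> Y}),
    E i p ->
    ext_equiv i p (@split_inj Z Y : {linear Z -> (Z * Y)%type})
                  (snd : {linear (Z * Y)%type -> Y}).

(* N / N', for submodules N' <= N of M. *)
Definition section (M : lmodType R) (N' N : submodClosed M) : lmodType R :=
  quotmod (submod_restr N' (N := N)).

(* Indices are shifted by one: [F i] is M^(i-1), so F 0 = M^(-1) = 0 and
   F ell.+1 = M^ell = M. *)
Definition E_filtration (M : lmodType R) (ell : nat)
    (F : nat -> submodClosed M) : Prop :=
  [/\ (forall x : M, x \in F 0 <-> x = 0),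
      (forall x : M, x \in F ell.+1)
    & forall i : nat, (i <= ell)%N ->
        exists sF : {subset F i <= F i.+1},
          E (submod_incl sF : {linear submod (F i) -> submod (F i.+1)})
            (@quot_proj R (submod (F i.+1)) (submod_restr (F i) (N := F i.+1))
               : {linear submod (F i.+1) -> section (F i) (F i.+1)})].

Variables (Omega : finType) (S : Omega -> lmodType R).

Definition in_addS (M : lmodType R) : Prop :=
  exists (n : nat) (w : 'I_n -> Omega), iso M (dirsum (fun i => S (w i))).

Definition in_AES (M : lmodType R) : Prop :=
  A M /\ exists (ell : nat) (F : nat -> submodClosed M),
    E_filtration ell F /\
    forall i : nat, (i <= ell)%N -> in_addS (section (F i) (F i.+1)).

(* Condition (1) on X_w: M has an E-filtration with lowest section
   isomorphic to S_w and all other sections in add S. *)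
Definition has_lowest_section (w : Omega) (M : lmodType R) : Prop :=
  exists (ell : nat) (F : nat -> submodClosed M),
    [/\ E_filtration ell F,
        iso (submod (F 1)) (S w)
      & forall i : nat, (0 < i <= ell)%N -> in_addS (section (F i) (F i.+1))].

End ExactCategories.

Record mod_functor (A B : pzRingType) := ModFunctor {
  fobj :> rmodType A -> rmodType B;
  fmap : forall M N : rmodType A, {linear M -> N} -> {linear fobj M -> fobj N};
  fmap_id : forall M : rmodType A, fmap (idfun : {linear M -> M}) =1 idfun;
  fmap_comp : forall (L M N : rmodType A) (g : {linear M -> N}) (f : {linear L -> M}),
    fmap (g \o f : {linear L -> N}) =1 fmap g \o fmap f
}.

(* A natural isomorphism from G \o F to the identity of the category of
   right A-modules. *)
Definition inverse_functor (A B : pzRingType)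
    (F : mod_functor A B) (G : mod_functor B A) : Prop :=
  exists eta : forall M : rmodType A, {linear G (F M) -> M},
    (forall M, bijective (eta M)) /\
    (forall (M N : rmodType A) (f : {linear M -> N}),
       eta N \o fmap G (fmap F f) =1 f \o eta M).

Definition morita_equivalent (A B : pzRingType) : Prop :=
  exists (F : mod_functor A B) (G : mod_functor B A),
    inverse_functor F G /\ inverse_functor G F.

(* Main.v *)
(* Vanishing of Ext^1_E(S_w, V) for all w makes every map into V extend along
   each step of an E-filtration with sections in S. Hence every map S_w -> X_w'
   factors through the inclusion of the lowest section S_w -> Y_w, and, by
   induction along a filtration of X_w, there are finitely many maps
   f_j : X_w -> Y_(v j) such that every map X_w -> X_w has the form
   sum_j k_j f_j. Taking the identity of X_w, the identity of T = (+)_w X_w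
   is a sum of endomorphisms factoring through T' = (+)_w Y_w, and conversely.
   Then Hom(T, T') and Hom(T', T) form a Morita context with surjective
   pairings, and M |-> Hom_End(T)(Hom(T, T'), M) is an equivalence. *)
From HB Require Import structures.
Require Import Defs.
From mathcomp Require Import all_boot all_algebra.
From mathcomp Require Import boolp.
Import GRing.Theory.
Local Open Scope ring_scope.

Set Implicit Arguments.
Unset Strict Implicit.
Unset Printing Implicit Defensive.

(** * Hom groups as right modules, and the Hom functors between endomorphism rings *)

(* [{linear Q -> M}] as a right B-module, B acting on Q from the left through
   [lam]: (f . b)(q) = f (b q). *)
Definition hom_along (R B : pzRingType) (Q : lmodType R)
  (lam : {rmorphism B -> endo Q}) (M : lmodType R) : Type := {linear Q -> M}.

Section HomAlong.
Variables (R B : pzRingType) (Q : lmodType R).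
Variables (lam : {rmorphism B -> endo Q}) (M : lmodType R).
Local Notation V := (hom_along lam M).

HB.instance Definition _ := gen_eqMixin V.
HB.instance Definition _ := gen_choiceMixin V.

Implicit Types f g : V.

Fact hom_along_add_linear f g :
  linear (fun x => (f : {linear Q -> M}) x + (g : {linear Q -> M}) x).
Proof. by move=> a x y; rewrite !linearP scalerDr addrACA. Qed.
Fact hom_along_opp_linear f : linear (fun x => - (f : {linear Q -> M}) x).
Proof. by move=> a x y; rewrite linearP opprD scalerN. Qed.
Fact hom_along_zero_linear : linear (fun _ : Q => 0 : M).
Proof. by move=> a x y; rewrite scaler0 addr0. Qed.

Definition hom_along_add f g : V :=
  HB.pack (fun x => (f : {linear Q -> M}) x + (g : {linear Q -> M}) x)
    (GRing.isLinear.Build R Q M _ _ (hom_along_add_linear f g)).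
Definition hom_along_opp f : V :=
  HB.pack (fun x => - (f : {linear Q -> M}) x)
    (GRing.isLinear.Build R Q M _ _ (hom_along_opp_linear f)).
Definition hom_along_zero : V :=
  HB.pack (fun _ : Q => 0 : M)
    (GRing.isLinear.Build R Q M _ _ hom_along_zero_linear).
Definition hom_along_scale (b : B^c) f : V :=
  ((f : {linear Q -> M}) \o (lam b : {linear Q -> Q}) : {linear Q -> M}).

Fact hom_along_addA : associative hom_along_add.
Proof. by move=> f g h; apply: linear_ext => x; exact: addrA. Qed.
Fact hom_along_addC : commutative hom_along_add.
Proof. by move=> f g; apply: linear_ext => x; exact: addrC. Qed.
Fact hom_along_add0 : left_id hom_along_zero hom_along_add.
Proof. by move=> f; apply: linear_ext => x; exact: add0r. Qed.
Fact hom_along_addN : left_inverse hom_along_zero hom_along_opp hom_along_add.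
Proof. by move=> f; apply: linear_ext => x; exact: addNr. Qed.

HB.instance Definition _ := GRing.isZmodule.Build V
  hom_along_addA hom_along_addC hom_along_add0 hom_along_addN.

Fact hom_along_scaleA a b f :
  hom_along_scale a (hom_along_scale b f) = hom_along_scale (a * b) f.
Proof.
apply: linear_ext => x; rewrite /hom_along_scale /=.
(* Here [a * b] is the product in [B^c], which is [b * a] in [B]; hence the swapped arguments. *)
by rewrite [lam (a * b)](rmorphM lam b a).
Qed.
Fact hom_along_scale1 : left_id 1 hom_along_scale.
Proof.
by move=> f; apply: linear_ext => x; rewrite /hom_along_scale [lam 1]rmorph1.
Qed.
Fact hom_along_scaleDr : right_distributive hom_along_scale +%R.
Proof. by move=> a f g; apply: linear_ext. Qed.
Fact hom_along_scaleDl f : {morph hom_along_scale^~ f : a b / a + b}.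
Proof.
move=> a b; apply: linear_ext => x; rewrite /hom_along_scale /=.
by rewrite [lam (a + b)](rmorphD lam) -linearD.
Qed.

HB.instance Definition _ := GRing.Zmodule_isLmodule.Build B^c V
  hom_along_scaleA hom_along_scale1 hom_along_scaleDr hom_along_scaleDl.
End HomAlong.

Section HomAlongFunctor.
Variables (R B : pzRingType) (Q : lmodType R) (lam : {rmorphism B -> endo Q}).

Definition hom_along_map (M N : lmodType R) (g : {linear M -> N})
  (f : hom_along lam M) : hom_along lam N :=
  (g \o (f : {linear Q -> M}) : {linear Q -> N}).

Fact hom_along_map_linear (M N : lmodType R) (g : {linear M -> N}) :
  linear (hom_along_map g).
Proof. by move=> a f f'; apply: linear_ext => x; exact: linearD. Qed.

HB.instance Definition _ (M N : lmodType R) (g : {linear M -> N}) :=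
  GRing.isLinear.Build B^c (hom_along lam M) (hom_along lam N) _
    (hom_along_map g) (hom_along_map_linear g).
End HomAlongFunctor.

(* A right [endo T]-module by precomposition. *)
Definition hom (R : pzRingType) (T T' : lmodType R) : Type :=
  hom_along (idfun : {rmorphism endo T -> endo T}) T'.

Section Hom.
Variables (R : pzRingType) (T T' : lmodType R).

HB.instance Definition _ := GRing.Lmodule.on (hom T T').

Definition hom_postcomp (b : endo T') : endo (hom T T') :=
  (hom_along_map (b : {linear T' -> T'})
     : {linear hom T T' -> hom T T'}).

Fact hom_postcomp_zmod_morphism : zmod_morphism hom_postcomp.
Proof. by move=> b c; apply: linear_ext => f; apply: linear_ext. Qed.
Fact hom_postcomp_monoid_morphism : monoid_morphism hom_postcomp.
Proof. by split=> [|b c]; apply: linear_ext => f; apply: linear_ext. Qed.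

HB.instance Definition _ := GRing.isZmodMorphism.Build _ _ hom_postcomp
  hom_postcomp_zmod_morphism.
HB.instance Definition _ := GRing.isMonoidMorphism.Build _ _ hom_postcomp
  hom_postcomp_monoid_morphism.

(** Kept transparent because the later constructions compute with its values on objects and maps. *)
Definition hom_functor : mod_functor (endo T) (endo T').
Proof.
refine (@ModFunctor (endo T) (endo T')
  (fun M => hom_along hom_postcomp M)
  (fun M N g => hom_along_map g : {linear _ -> _}) _ _).
- by move=> M f; apply: linear_ext.
- by move=> L M N g f h; apply: linear_ext.
Defined.
End Hom.

(** * The Morita context of [T] and [T'] *)

Definition hom_comp (R : pzRingType) (T T' : lmodType R)
    (q : hom T' T) (p : hom T T') : endo T :=
  ((q : {linear T' -> T}) \o (p : {linear T -> T'}) : {linear T -> T}).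

(** Surjectivity of the pairing [hom_comp] onto [endo T]: its image generates an ideal containing 1.
    Equivalently, [T] is a direct summand of a finite power of [T']. *)
Definition factors_through (R : pzRingType) (T T' : lmodType R) : Prop :=
  exists (J : finType) (a : J -> hom T T') (b : J -> hom T' T),
    \sum_j hom_comp (b j) (a j) = 1 :> endo T.

Section MoritaContext.
Variables (R : pzRingType) (T T' : lmodType R) (J : finType).
Variables (a : J -> hom T T') (b : J -> hom T' T).
Hypothesis baK : \sum_j hom_comp (b j) (a j) = 1 :> endo T.

Section Unit.
Variable M : rmodType (endo T).
Local Notation GFM := (hom_functor T' T (hom_functor T T' M)).

Definition hom_eval (phi : GFM) (q : hom T' T) (p : hom T T') : M :=
  ((phi : {linear hom T' T -> hom_functor T T' M}) q
    : {linear hom T T' -> M}) p.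

(** An element [phi] is a balanced pairing of [q] and [p] with values in [M]; this is its value at
    the expression of the identity of [T] given by [baK]. *)
Definition morita_unit (phi : GFM) : M := \sum_j hom_eval phi (b j) (a j).

(** By [baK], q is the sum of the b_j (a_j q). Linearity of [phi] over [endo T'] moves a_j q over to
    p, and linearity over [endo T] extracts q p from a_j (q p). *)
Lemma hom_evalE phi q p :
  hom_eval phi q p = (hom_comp q p : (endo T)^c) *: morita_unit phi.
Proof.
have qE : q = \sum_j (hom_comp (a j) q : (endo T')^c) *: b j.
  apply: linear_ext => x.
  pose ev (f : endo T) := (f : {linear T -> T}) ((q : {linear T' -> T}) x).
  pose ev' (f : hom T' T) := (f : {linear T' -> T}) x.
  rewrite -[LHS]/(ev 1) -baK -[RHS]/(ev' _).
  by rewrite (big_morph ev (id1 := 0) (op1 := +%R)) //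
    (big_morph ev' (id1 := 0) (op1 := +%R)).
have evq_sum (I : finType) (F : I -> hom T' T) :
    hom_eval phi (\sum_i F i) p = \sum_i hom_eval phi (F i) p.
  apply: (big_morph (fun q => hom_eval phi q p)) => [q1 q2|].
    by rewrite /hom_eval linearD.
  by rewrite /hom_eval linear0.
rewrite {1}qE evq_sum /morita_unit scaler_sumr; apply: eq_bigr => j _.
pose g : {linear hom T T' -> M} :=
  (phi : {linear hom T' T -> hom_functor T T' M}) (b j).
have gZ (c : (endo T)^c) p' : g (c *: p') = c *: g p' by rewrite linearZ.
transitivity (g ((hom_comp q p : (endo T)^c) *: a j)); last exact: gZ.
by rewrite /hom_eval linearZ; congr (g _); apply: linear_ext.
Qed.

Lemma morita_unit_linear : linear morita_unit.
Proof.
move=> c phi psi; rewrite [LHS]big_split /=; congr (_ + _).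
(* The scalar c acts by replacing b_j with c b_j, so [hom_evalE] gives the scalar c b_j a_j in each
   term; then [baK] applies. *)
transitivity (\sum_j (hom_comp (b j) (a j) : (endo T)^c) *:
                (c *: morita_unit phi)).
  apply: eq_bigr => j _.
  rewrite -[LHS]/(hom_eval phi (hom_postcomp T' c (b j)) (a j)).
  by rewrite hom_evalE scalerA; congr (_ *: _); apply: linear_ext.
by rewrite -scaler_suml baK [LHS]scale1r.
Qed.

Definition morita_unit_map : {linear GFM -> M} :=
  HB.pack morita_unit
    (GRing.isLinear.Build (endo T)^c GFM M _ _ morita_unit_linear).

(* The inverse of [morita_unit]: m is sent to q |-> p |-> m . (q p). *)
Fact morita_counit_in_linear (m : M) (q : hom T' T) :
  linear (fun p : hom T T' => (hom_comp q p : (endo T)^c) *: m).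
Proof.
move=> c p p'; rewrite scalerA -scalerDl; congr (_ *: _).
by apply: linear_ext => x; rewrite /= linearD.
Qed.

Definition morita_counit_in (m : M) (q : hom T' T) : hom_functor T T' M :=
  HB.pack (fun p : hom T T' => (hom_comp q p : (endo T)^c) *: m)
    (GRing.isLinear.Build (endo T)^c (hom T T') M _ _
      (morita_counit_in_linear m q)).

Fact morita_counit_out_linear (m : M) : linear (morita_counit_in m).
Proof.
move=> c q q'; apply: linear_ext => p.
apply: etrans (scalerDl m (hom_comp q (hom_postcomp T c p) : (endo T)^c)
                 (hom_comp q' p)).
by congr (_ *: _); apply: linear_ext.
Qed.

Definition morita_counit (m : M) : GFM :=
  HB.pack (morita_counit_in m)
    (GRing.isLinear.Build (endo T')^c (hom T' T) (hom_functor T T' M) _ _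
      (morita_counit_out_linear m)).

Lemma morita_unit_bij : bijective morita_unit.
Proof.
exists morita_counit => [phi|m].
  by apply: linear_ext => q; apply: linear_ext => p; exact: esym (hom_evalE phi q p).
by rewrite /morita_unit -scaler_suml baK [LHS]scale1r.
Qed.
End Unit.
End MoritaContext.

Lemma hom_functor_inverse (R : pzRingType) (T T' : lmodType R) :
  factors_through T T' ->
  inverse_functor (hom_functor T T') (hom_functor T' T).
Proof.
move=> [J [a [b baK]]].
exists (morita_unit_map baK).
split=> [M|M N f phi]; first exact: morita_unit_bij.
by rewrite [RHS]linear_sum.
Qed.

Lemma endo_morita_equivalent (R : pzRingType) (T T' : lmodType R) :
  factors_through T T' -> factors_through T' T ->
  morita_equivalent (endo T) (endo T').
Proof.
move=> TT' T'T; exists (hom_functor T T'), (hom_functor T' T).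
by split; apply: hom_functor_inverse.
Qed.

(** * Factoring linear maps, and the maps of a finite direct sum *)

Section Modules.
Variable R : pzRingType.
Implicit Types U V W M N : lmodType R.

Definition linear_of U V (f : U -> V) (f_lin : linear f) : {linear U -> V} :=
  HB.pack f (GRing.isLinear.Build R U V _ f f_lin).

Lemma linear_factor_inj U V W (i : {linear U -> V}) (f : {linear W -> V}) :
  injective i -> (forall w, exists x, i x = f w) ->
  exists g : {linear W -> U}, i \o g =1 f.
Proof.
move=> i_inj fi; pose g w := projT1 (cid (fi w)).
have gE w : i (g w) = f w by rewrite /g; case: cid.
have g_lin : linear g.
  by move=> a x y; apply: i_inj; rewrite linearP !gE linearP.
by exists (linear_of g_lin).
Qed.

Lemma linear_factor_surj U V W (p : {linear U -> V}) (f : {linear U -> W}) :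
  (forall y, exists x, p x = y) -> (forall x, p x = 0 -> f x = 0) ->
  exists g : {linear V -> W}, g \o p =1 f.
Proof.
move=> p_surj fp; pose s y := projT1 (cid (p_surj y)).
have sE y : p (s y) = y by rewrite /s; case: cid.
have fsE x : f (s (p x)) = f x.
  by apply/eqP; rewrite -subr_eq0 -linearB fp // linearB sE subrr.
have g_lin : linear (f \o s).
  move=> a x y /=; rewrite -linearP -[RHS]fsE; congr (f (s _)).
  by rewrite linearP !sE.
by exists (linear_of g_lin).
Qed.

Lemma linear_sum_map U V (J : finType) (f : J -> {linear U -> V}) :
  exists g : {linear U -> V}, forall x, g x = \sum_j f j x.
Proof.
have g_lin : linear (fun x => \sum_j f j x).
  move=> a x y; rewrite scaler_sumr -big_split.
  by apply: eq_bigr => j _; rewrite linearP.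
by exists (linear_of g_lin).
Qed.

Lemma linear_inverse U V (f : {linear U -> V}) :
  bijective f -> exists g : {linear V -> U}, cancel f g /\ cancel g f.
Proof.
move=> [g fK gK]; have g_lin : linear g.
  by move=> a x y; rewrite -{1}[x]gK -{1}[y]gK -linearP fK.
by exists (linear_of g_lin).
Qed.

Section DirsumMaps.
Variables (I : finType) (X : I -> lmodType R).

Definition dirsum_proj (i : I) (x : dirsum X) : X i := x i.

Fact dirsum_proj_linear i : linear (dirsum_proj i).
Proof. by []. Qed.
HB.instance Definition _ i :=
  GRing.isLinear.Build R (dirsum X) (X i) _ (dirsum_proj i) (dirsum_proj_linear i).

Definition dirsum_inj (i : I) (x : X i) : dirsum X :=
  dfwith (0 : dirsum X) x.

Lemma dirsum_injE i (x : X i) : dirsum_inj x i = x.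
Proof. exact: dfwith_in. Qed.

Lemma dirsum_inj0 i j (x : X i) : i != j -> dirsum_inj x j = 0.
Proof. exact: dfwith_out. Qed.

Fact dirsum_inj_linear i : linear (@dirsum_inj i).
Proof.
move=> a x y; apply: functional_extensionality_dep => j.
rewrite [RHS]/(a *: dirsum_inj x j + dirsum_inj y j).
have [<-|nij] := eqVneq i j; first by rewrite !dirsum_injE.
by rewrite !dirsum_inj0 // scaler0 [RHS]addr0.
Qed.
HB.instance Definition _ i :=
  GRing.isLinear.Build R (X i) (dirsum X) _ (@dirsum_inj i) (@dirsum_inj_linear i).

Lemma dirsum_sumE (x : dirsum X) : x = \sum_i dirsum_inj (dirsum_proj i x).
Proof.
apply: functional_extensionality_dep => j.
rewrite -[RHS]/(dirsum_proj j _) linear_sum (bigD1 j) //= big1 => [|i nij].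
  by rewrite addr0 [RHS]dirsum_injE.
exact: dirsum_inj0.
Qed.
End DirsumMaps.
End Modules.

(** * Lifting and extending maps when Ext^1 vanishes *)

Section Extension.
Variables (R : pzRingType) (A : mod_class R) (E : seq_class R).
Hypothesis hAE : strict_full_exact_subcategory A E.
Implicit Types U V W Z Q P C : lmodType R.

(** The pullback of [p] along [u] is an extension of [W] by [V] in [E], hence splits; a splitting
    followed by the projection to [P] lifts [u]. *)
Lemma ext_vanishing_lift V P Q W (i : {linear V -> P}) (p : {linear P -> Q})
    (u : {linear W -> Q}) :
  E i p -> A W -> Ext1_eq0 E W V -> exists s : {linear W -> P}, p \o s =1 u.
Proof.
move=> Eip AW ext0.
have [P' [p' [f' [[AP' comm0 univ] [K [k Ekp']]]]]] :=
  deflation_pullback hAE u (ex_intro _ V (ex_intro _ i Eip) : deflation E p) AW.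
have comm x : u (p' x) = p (f' x) := comm0 x.
have [i_inj p_ker _] := conflation_exact hAE Eip.
have [k_inj p'_ker _] := conflation_exact hAE Ekp'.
have [AV AP AQ] := conflation_subcat hAE Eip.
have [AK _ _] := conflation_subcat hAE Ekp'.
have pi0 v : p (i v) = 0 by apply/p_ker; exists v.
have p'k0 x : p' (k x) = 0 by apply/p'_ker; exists x.
(* The axiom only gives some kernel [k] of [p']. The map [c] with components 0 and [i] should be a
   kernel too, so [a] and [d] are built as inverse maps between [K] and [V]. *)
have [c [[p'c f'c] _]] : exists! c : {linear V -> P'},
    p' \o c =1 (\0 : {linear V -> W}) /\ f' \o c =1 i.
  by apply: univ => // v /=; rewrite linear0 pi0.
have [a aE] : exists a : {linear K -> V}, i \o a =1 f' \o k.
  by apply: linear_factor_inj => // x; apply/p_ker; rewrite /= -comm p'k0 linear0.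
have [d dE] : exists d : {linear V -> K}, k \o d =1 c.
  by apply: linear_factor_inj => // v; apply/p'_ker; apply: p'c.
have da : cancel d a.
  by move=> v; apply: i_inj; rewrite [LHS]aE /= [k _]dE [LHS]f'c.
(* P' lies in A, so maps from K to P' agree when their two components do. *)
have ca x : c (a x) = k x.
  have [t [_ t_uniq]] : exists! t : {linear K -> P'},
      p' \o t =1 (\0 : {linear K -> W}) /\ f' \o t =1 f' \o k.
    by apply: univ => // y /=; rewrite linear0 -comm /= p'k0 linear0.
  have tk : t = k by apply: t_uniq; split.
  have : t = c \o a; last by rewrite tk => ->.
  by apply: t_uniq; split=> y; [apply: p'c|rewrite /= [LHS]f'c [LHS]aE].
have ad : cancel a d by move=> x; apply: k_inj; rewrite [LHS]dE ca.
(* The pulled back extension of W by V. *)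
have Ecp' : E c p'.
  apply: (conflation_iso hAE (a := a) (b := idfun) (c := idfun) _ _ _ _ _ Ekp').
  - by exists d.
  - by exists id.
  - by exists id.
  - by move=> x; rewrite /= ca.
  - by [].
have [b [b_bij _ sb]] := ext0 _ _ _ Ecp'.
have [b' [_ b'K]] := linear_inverse b_bij.
(* The splitting is w |-> (0, w), transported to [P'] by the inverse of [b]. *)
have s_lin : linear (fun w => f' (b' (0, w))).
  move=> r x y; rewrite -!linearP; congr (f' (b' _)).
  by apply/eqP; rewrite xpair_eqE /= scaler0 addr0 !eqxx.
exists (linear_of s_lin) => w; rewrite /= -comm -sb /=.
by rewrite b'K.
Qed.

Variables (Omega : finType) (S : Omega -> lmodType R).
Hypothesis AS : forall w, A (S w).

(* Q is a direct sum of objects S w, so lifting each inclusion into Q gives a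
   section of p. *)
Lemma ext_vanishing_retract V P Q (i : {linear V -> P}) (p : {linear P -> Q}) :
  E i p -> in_addS S Q -> (forall w, Ext1_eq0 E (S w) V) ->
  exists r : {linear P -> V}, cancel i r.
Proof.
move=> Eip [n [w [e /linear_inverse[e' [eK e'K]]]]] ext0.
have [i_inj p_ker _] := conflation_exact hAE Eip.
have sP j := cid (ext_vanishing_lift (e' \o (@dirsum_inj _ _ (fun j => S (w j)) j))
   Eip (AS (w j)) (ext0 (w j))).
have [s sE] := linear_sum_map (fun j => projT1 (sP j) \o dirsum_proj j \o e).
have psK x : p (s x) = x.
  rewrite sE linear_sum -[RHS]eK [in RHS](dirsum_sumE (e x)) linear_sum.
  by apply: eq_bigr => j _; case: (sP j) => t /= tE; apply: tE.
have r_lin : linear (fun x => x - s (p x)).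
  by move=> a x y; rewrite (linearP p) (linearP s) scalerBr opprD addrACA.
have [r rE] : exists r : {linear P -> V}, i \o r =1 linear_of r_lin.
  apply: linear_factor_inj => // x; apply/p_ker.
  by rewrite /= linearB psK subrr.
exists r => v; apply: i_inj; rewrite [LHS]rE /=.
have -> : p (i v) = 0 by apply/p_ker; exists v.
by rewrite linear0 subr0.
Qed.

(** In the pushout of [i] along [f], the inflation [i'] out of [V] has cokernel isomorphic to [Q],
    so it has a retraction r; then r f' i = r i' f = f. *)
Lemma ext_vanishing_extend U Z Q V (i : {linear U -> Z}) (p : {linear Z -> Q})
    (f : {linear U -> V}) :
  E i p -> in_addS S Q -> A V -> (forall w, Ext1_eq0 E (S w) V) ->
  exists g : {linear Z -> V}, g \o i =1 f.
Proof.
move=> Eip addQ AV ext0.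
have [P [i' [f' [[AP comm0 univ] [C [q Eiq]]]]]] :=
  inflation_pushout hAE f (ex_intro _ Q (ex_intro _ p Eip) : inflation E i) AV.
have comm x : i' (f x) = f' (i x) := comm0 x.
have [_ p_ker p_surj] := conflation_exact hAE Eip.
have [_ q_ker q_surj] := conflation_exact hAE Eiq.
have [AU AZ AQ] := conflation_subcat hAE Eip.
have [_ _ AC] := conflation_subcat hAE Eiq.
have pi0 x : p (i x) = 0 by apply/p_ker; exists x.
have qi0 x : q (i' x) = 0 by apply/q_ker; exists x.
have [c [[ci cf] _]] : exists! c : {linear P -> Q},
    c \o i' =1 (\0 : {linear V -> Q}) /\ c \o f' =1 p.
  by apply: univ => // x /=; rewrite pi0.
have [d dE] : exists d : {linear Q -> C}, d \o p =1 q \o f'.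
  apply: linear_factor_surj => // x /p_ker[y <-] /=.
  by rewrite -comm qi0.
have [g gE] : exists g : {linear C -> Q}, g \o q =1 c.
  by apply: linear_factor_surj => // x /q_ker[y <-]; apply: ci.
have gd : cancel d g.
  by move=> x; have [z <-] := p_surj x; rewrite [d _]dE [LHS]gE [LHS]cf.
(* Both maps have the same restrictions along [i'] and [f'], and [C] lies in [A], so uniqueness for
   the pushout identifies them. *)
have dc x : d (c x) = q x.
  have [t [_ t_uniq]] : exists! t : {linear P -> C},
      t \o i' =1 (\0 : {linear V -> C}) /\ t \o f' =1 q \o f'.
    by apply: univ => // y; rewrite /= -comm qi0.
  have tq : t = q by apply: t_uniq; split.
  have : t = d \o c; last by rewrite tq => ->.
  apply: t_uniq; split=> y /=; first by rewrite [c _]ci linear0.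
  by rewrite [c _]cf [LHS]dE.
have dg : cancel g d.
  by move=> x; have [z <-] := q_surj x; rewrite [g _]gE dc.
(* The pushout has the same cokernel: C is isomorphic to Q. *)
have addC : in_addS S C.
  have [n [w [e e_bij]]] := addQ; exists n, w, (e \o g).
  by apply: bij_comp => //; exists d.
have [r rK] := ext_vanishing_retract Eiq addC ext0.
by exists (r \o f') => x; rewrite /= -comm /= rK.
Qed.

(** Each step of the filtration above the lowest is a conflation to which [ext_vanishing_extend]
    applies. *)
Lemma filtration_extend (M V : lmodType R) (ell : nat) (F : nat -> submodClosed M)
    (f : {linear submod (F 1) -> V}) :
  E_filtration E ell F ->
  (forall i, (0 < i <= ell)%N -> in_addS S (section (F i) (F i.+1))) ->
  A V -> (forall w, Ext1_eq0 E (S w) V) ->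
  exists g : {linear M -> V}, forall x : submod (F 1), g (val x) = f x.
Proof.
move=> [_ Ftop Fstep] addF AV ext0.
(* By the index shift, stage [j] concerns [F j.+1]: the induction starts at the lowest section [F 1]
   and ends at [F ell.+1], which is all of [M]. *)
have Fext j : (j <= ell)%N -> exists (s : {subset F 1 <= F j.+1})
    (g : {linear submod (F j.+1) -> V}), forall x, g (submod_incl s x) = f x.
  elim: j => [_|j IHj ltjl].
    by exists (fun _ => id), f => x; congr (f _); apply: val_inj.
  have [s [g gE]] := IHj (ltnW ltjl).
  have [sF /ext_vanishing_extend] := Fstep _ ltjl.
  move=> /(_ V g (addF j.+1 ltjl) AV ext0)[g' g'E].
  exists (fun x xF => sF x (s x xF)), g' => x.
  by rewrite -gE -g'E; congr (g' _); apply: val_inj.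
have [s [g gE]] := Fext ell (leqnn ell).
have t_lin : linear (fun x => exist _ x (Ftop x) : submod (F ell.+1)).
  by move=> a x y; apply: val_inj.
exists (g \o linear_of t_lin) => x; rewrite -gE.
by congr (g _); apply: val_inj.
Qed.

(** * Approximating maps into [V] through the family [Y] *)

(** The [f j] are chosen before [h]. Jointly they form a map from [M] to a finite sum of members of
    [Y], a left approximation tested only against [V]. *)
Definition approximable (Y : Omega -> lmodType R) (V M : lmodType R) : Prop :=
  exists (J : finType) (v : J -> Omega) (f : forall j, {linear M -> Y (v j)}),
    forall h : {linear M -> V}, exists k : forall j, {linear Y (v j) -> V},
      forall x, h x = \sum_j k j (f j x).

Variables (Y : Omega -> lmodType R) (V : lmodType R).
Hypothesis AY : forall w, A (Y w).
Hypothesis Y_lowest : forall w, has_lowest_section E S w (Y w).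
Hypothesis Y_ext0 : forall w w', Ext1_eq0 E (S w') (Y w).
Hypothesis AV : A V.
Hypothesis V_ext0 : forall w, Ext1_eq0 E (S w) V.

(** Take for [f] the inclusion of the lowest section of [Y w]; then [k] is an extension of [h] along
    the filtration. *)
Lemma lowest_section_approx w :
  exists f : {linear S w -> Y w}, forall h : {linear S w -> V},
    exists k : {linear Y w -> V}, k \o f =1 h.
Proof.
have [ell [F [Ffilt [e /linear_inverse[e' [_ e'K]]] Fadd]]] := Y_lowest w.
exists ((val : {linear submod (F 1) -> Y w}) \o e') => h.
have [k kE] := filtration_extend (h \o e) Ffilt Fadd AV V_ext0.
by exists k => x; rewrite /= kE /= e'K.
Qed.

(** The approximating maps of [U] extend to [Z] because Ext^1 into [Y] vanishes. A map on [Z],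
    corrected by these, descends to [Q], whose summands are handled by [lowest_section_approx]. *)
Lemma approximable_extension U Z Q (i : {linear U -> Z}) (p : {linear Z -> Q}) :
  E i p -> in_addS S Q -> approximable Y V U -> approximable Y V Z.
Proof.
move=> Eip addQ [J [v [f fP]]].
have [n [w [e /linear_inverse[e' [eK e'K]]]]] := addQ.
have [_ p_ker p_surj] := conflation_exact hAE Eip.
have f'P j := cid (ext_vanishing_extend (f j) Eip addQ (AY (v j)) (@Y_ext0 (v j))).
have gP l := cid (lowest_section_approx (w l)).
pose v' (j : J + 'I_n) := match j with inl j => v j | inr l => w l end.
pose f' (j : J + 'I_n) : {linear Z -> Y (v' j)} :=
  match j with
  | inl j => projT1 (f'P j)
  | inr l => projT1 (gP l) \o (dirsum_proj l \o (e \o p))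
  end.
exists (J + 'I_n)%type, v', f' => h.
have [k kE0] := fP (h \o i).
have kE u : h (i u) = \sum_j k j (f j u) := kE0 u.
have [t tE] := linear_sum_map (fun j => k j \o projT1 (f'P j)).
have d_lin : linear (fun z => h z - t z).
  by move=> a x y; rewrite (linearP h) (linearP t) scalerBr opprD addrACA.
(* h - t vanishes on U, hence factors through Q. *)
have [m mE] : exists m : {linear Q -> V}, m \o p =1 linear_of d_lin.
  apply: linear_factor_surj => // x /p_ker[u <-] /=.
  rewrite tE kE -sumrB big1 // => j _ /=.
  by case: (f'P j) => g /= gE; rewrite -(gE u) subrr.
(* Restricted to the summand [S (w l)] of [Q], the map [m] factors through [Y (w l)]. *)
have m'P l := cid (projT2 (gP l) (m \o (e' \o @dirsum_inj _ _ (fun l => S (w l)) l))).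
exists (fun j => match j return {linear Y (v' j) -> V} with
  | inl j => k j | inr l => projT1 (m'P l) end) => z.
rewrite big_sumType /= -tE; apply/eqP; rewrite addrC -subr_eq; apply/eqP.
rewrite -[LHS]mE /= -[in LHS](eK (p z)) [in LHS](dirsum_sumE (e (p z))).
rewrite !linear_sum; apply: eq_bigr => l _.
by case: (m'P l) => m' /= m'E; rewrite [RHS]m'E.
Qed.

Lemma filtered_approximable (M : lmodType R) : in_AES A E S M -> approximable Y V M.
Proof.
move=> [_ [ell [F [[F0 Ftop Fstep] Fadd]]]].
have Fapp j : (j <= ell.+1)%N -> approximable Y V (submod (F j)).
  elim: j => [_|j IHj ltjl].
    (* [F 0] is zero, so the empty family approximates it. *)
    exists void, (fun j : void => match j with end), (fun j : void => match j with end).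
    move=> h; exists (fun j : void => match j with end) => x.
    have -> : x = 0 by apply: val_inj; apply/F0; apply: valP.
    by rewrite linear0 big_pred0 // => -[].
  have [sF Esec] := Fstep j ltjl.
  exact: approximable_extension Esec (Fadd j ltjl) (IHj (ltnW ltjl)).
have [J [v [f fP]]] := Fapp ell.+1 (leqnn _).
have t_lin : linear (fun x => exist _ x (Ftop x) : submod (F ell.+1)).
  by move=> a x y; apply: val_inj.
exists J, v, (fun j => f j \o linear_of t_lin) => h.
have [k kE] := fP (h \o (val : {linear submod (F ell.+1) -> M})).
by exists k => x; rewrite -kE.
Qed.
End Extension.

(** * From approximations to the Morita equivalence *)

(** Approximating the identity of each [X w] writes it as a sum of maps through members of [Y],
    hence through [dirsum Y]; these add up to the identity of [dirsum X]. *)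
Lemma dirsum_factors_through (R : pzRingType) (Omega : finType)
    (X Y : Omega -> lmodType R) :
  (forall w, approximable Y (X w) (X w)) ->
  factors_through (dirsum X) (dirsum Y).
Proof.
move=> appX.
have wP w : exists (J : finType) (a : J -> {linear X w -> dirsum Y})
    (b : J -> {linear dirsum Y -> X w}), forall x, x = \sum_j b j (a j x).
  have [J [v [f /(_ idfun)[k kE]]]] := appX w.
  exists J, (fun j => @dirsum_inj _ _ Y (v j) \o f j),
    (fun j => k j \o dirsum_proj (v j)) => x.
  rewrite [LHS]kE; apply: eq_bigr => j _ /=.
  by rewrite /dirsum_proj dirsum_injE.
(* The index types are fixed first, so that the sum can run over their disjoint union; the maps are
   then chosen over them. *)
pose J w := projT1 (cid (wP w)).
have aP w : {a : J w -> {linear X w -> dirsum Y} & 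
    {b : J w -> {linear dirsum Y -> X w} | forall x, x = \sum_j b j (a j x)}}.
  by rewrite /J; case: cid => /= ? /cid[a /cid[b ab]]; exists a, b.
pose a w := projT1 (aP w).
pose b w := projT1 (projT2 (aP w)).
have abE w x : x = \sum_j b w j (a w j x) := projT2 (projT2 (aP w)) x.
exists {w : Omega & J w},
  (fun j => a (tag j) (tagged j) \o dirsum_proj (tag j)),
  (fun j => @dirsum_inj _ _ X (tag j) \o b (tag j) (tagged j)).
apply: linear_ext => x; rewrite [RHS](dirsum_sumE x).
under [RHS]eq_bigr => w _ do rewrite [dirsum_proj w x]abE linear_sum.
rewrite sig_big_dep /=.
pose ev (f : endo (dirsum X)) := (f : {linear dirsum X -> dirsum X}) x.
by rewrite -[LHS]/(ev _) (big_morph ev (id1 := 0) (op1 := +%R)).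
Qed.
Theorem theorem3p4p2
  (K : comPzRingType) (H : pzRingType) (phi : {rmorphism K -> H})
  (hK : noetherian K)
  (hphi : central phi)
  (hfin : finitely_generated (alg_module phi : lmodType K))
  (hproj : projective (alg_module phi : lmodType K))
  (A : mod_class H^c) (E : seq_class H^c)
  (hAE : strict_full_exact_subcategory A E)
  (Omega : finType) (S : Omega -> rmodType H)
  (hSA : forall w : Omega, A (S w))
  (hS0 : forall w : Omega, exists x : S w, x != 0)
  (X Y : Omega -> rmodType H)
  (hXA : forall w : Omega, in_AES A E S (X w))
  (hX1 : forall w : Omega, has_lowest_section E S w (X w))
  (hX2 : forall w w' : Omega, Ext1_eq0 E (S w') (X w))
  (hYA : forall w : Omega, in_AES A E S (Y w))
  (hY1 : forall w : Omega, has_lowest_section E S w (Y w))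
  (hY2 : forall w w' : Omega, Ext1_eq0 E (S w') (Y w)) :
  morita_equivalent (endo (dirsum X)) (endo (dirsum Y)).
Proof.
have AX w : A (X w) by case: (hXA w).
have AY w : A (Y w) by case: (hYA w).
apply: endo_morita_equivalent; apply: dirsum_factors_through => w.
  (* [X w] serves both as the filtered source and as the target [V] on which Ext^1 vanishes. *)
  exact: (filtered_approximable hAE hSA AY hY1 hY2 (AX w) (hX2 w) (hXA w)).
exact: (filtered_approximable hAE hSA AX hX1 hX2 (AY w) (hY2 w) (hYA w)).
Qed.
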